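(* Let $p\ge 3$ and $n\ge 1$. For any discrete martingale-difference sequence $d=\{d_1,\dots,d_n\}$, $$\left\|\sum_{k=1}^n d_k\right\|_p\le \left\|\frac{1}{\sqrt n}\sum_{k=1}^n r_k\right\|_p\,\|\mathfrak S(d)\|_\infty,$$ where $r_k$ are the Rademacher functions. This bound is sharp: equality holds for $d_k=r_k/\sqrt n$, $k=1,\dots,n$ (with respect to the dyadic partitions of $[0,1)$).
   Context: All random variables are real-valued. Let $(X,\mathscr F,\mu)$ be a probability space. A discrete filtration is an increasing sequence of $\sigma$-algebras $\mathscr F_0\subset\mathscr F_1\subset\dots\subset\mathscr F$ such that each $\mathscr F_k$ is generated by a finite or countable partition $\mathscr D_k$ of $X$ into disjoint measurable sets of positive measure, where $\mathscr D_0=\{X\}$ and every set in $\mathscr D_k$ is a union of elements of $\mathscr D_{k+1}$. A discrete martingale-difference sequence $d=\{d_1,\dots,d_n\}$ with respect to such a filtration is a sequence of integrable random variables with $d_k$ being $\mathscr F_k$-measurable and $\int_V d_k\,d\mu=0$ for every $V\in\mathscr D_{k-1}$, $k=1,\dots,n$. Its square function is $$\mathfrak S(d)(x)=\Big(\sum_{k=1}^n |D_k(x)|^2\Big)^{1/2},\qquad D_k(x)=\sum_{V\in\mathscr D_{k-1}}\|\mathbf 1_V d_k\|_\infty\,\mathbf 1_V(x).$$ The Rademacher functions are $r_k(x)=\operatorname{sign}\sin(2^k\pi x)$, $k\ge1$, on $[0,1)$ with Lebesgue measure (independent, values $\pm1$ with probability $1/2$ each); they form a martingale-difference sequence with respect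 to the partitions $\mathscr D_k$ of $[0,1)$ into the dyadic intervals $[(j-1)/2^k,j/2^k)$, $1\le j\le 2^k$. *)

(* Defs.v *)
From HB Require Import structures.
From mathcomp Require Import all_boot all_order all_algebra.
From mathcomp Require Import all_classical all_reals all_analysis.

Set Implicit Arguments.
Unset Strict Implicit.
Unset Printing Implicit Defensive.

Import Order.TTheory GRing.Theory Num.Theory.
Import numFieldNormedType.Exports.

Local Open Scope classical_set_scope.
Local Open Scope ring_scope.

(** [D k] is the partition written D_k; the sigma-algebra F_k is [<<s D k >>]. *)
Record discrete_filtration (R : realType) (dd : measure_display)
    (X : measurableType dd) (mu : probability X R)
    (D : nat -> set (set X)) : Prop := DiscreteFiltration {
  dfilt_partition : forall k, partition (D k) id [set: X] ;
  dfilt_countable : forall k, countable (D k) ;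
  dfilt_measurable : forall k V, D k V -> measurable V ;
  dfilt_gt0 : forall k V, D k V -> (0 < mu V)%E ;
  dfilt0 : D 0%N = [set [set: X]] ;
  dfilt_refine : forall k V, D k V ->
    exists2 C : set (set X), C `<=` D k.+1 & V = \bigcup_(W in C) W ;
  dfilt_incr : forall k, <<s D k >> `<=` <<s D k.+1 >> }.

(** Only the terms [d 1, ..., d n] of the sequence [d] are used. *)
Record discrete_mds (R : realType) (dd : measure_display)
    (X : measurableType dd) (mu : probability X R)
    (D : nat -> set (set X)) (n : nat) (d : nat -> X -> R) : Prop :=
  DiscreteMds {
  dmds_filtration : discrete_filtration mu D ;
  dmds_integrable : forall k, (1 <= k <= n)%N ->
    mu.-integrable [set: X] (EFin \o d k) ;
  dmds_adapted : forall k, (1 <= k <= n)%N ->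
    measurable_fun [set: g_sigma_algebraType (D k)]
      (d k : g_sigma_algebraType (D k) -> R) ;
  dmds_integral0 : forall k, (1 <= k <= n)%N -> forall V, D k.-1 V ->
    (\int[mu]_(x in V) (d k x)%:E = 0)%E }.

Section square_function.
Local Open Scope ereal_scope.
Context (R : realType) (dd : measure_display) (X : measurableType dd).
Variables (mu : probability X R) (D : nat -> set (set X)).
Variable d : nat -> X -> R.

(** Extended-real valued, since a norm [||1_V d_k||_oo] may be infinite
    (recall that [+oo * 0 = 0]). *)
Definition local_sup_norm (k : nat) (x : X) : \bar R :=
  \esum_(V in D k.-1)
    ('N[mu]_+oo[EFin \o (\1_V \* d k)%R] * (\1_V x)%:E).

Definition square_function (n : nat) (x : X) : \bar R :=
  sqrte (\sum_(1 <= k < n.+1) `|local_sup_norm k x| ^+ 2).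

End square_function.

(** The probability space [0, 1[, with the trace of the Borel sigma-algebra and
    Lebesgue measure. *)
Section unit_interval.
Variable R : realType.

Definition Ico01 : Type := {x : R | x \in `[0%R, 1%R[}.

Definition Ico01_val (x : Ico01) : measurableTypeR R := \val x.

Let zero_in_Ico01 : (0 : R) \in `[0%R, 1%R[.
Proof. by rewrite in_itv/= lexx ltr01. Qed.

HB.instance Definition _ := Choice.on Ico01.
HB.instance Definition _ :=
  isPointed.Build Ico01 (exist (fun x : R => x \in `[0%R, 1%R[) 0 zero_in_Ico01).

Definition unitIco : Type := g_sigma_algebra_preimageType Ico01_val.

HB.instance Definition _ := Measurable.on unitIco.

Definition unitIco_val (x : unitIco) : R := Ico01_val x.

Lemma unitIco_val_inj : injective unitIco_val.
Proof. exact: val_inj. Qed.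

Lemma range_unitIco_val : range unitIco_val = [set` `[0%R, 1%R[].
Proof.
apply/seteqP; split => [_ [x _ <-]|x x01]; first exact: (valP x).
by exists (exist _ x x01).
Qed.

Lemma measurable_image_unitIco_val (A : set unitIco) : measurable A ->
  measurable (unitIco_val @` A : set (measurableTypeR R)).
Proof.
case=> B mB <-; rewrite setTI.
suff -> : unitIco_val @` (Ico01_val @^-1` B) = [set` `[0%R, 1%R[] `&` B.
  by apply: measurableI.
rewrite -range_unitIco_val; apply/seteqP; split.
- by move=> _ [x Bx <-]; split => //; exists x.
- by move=> _ [[x _ <-] Bx]; exists x.
Qed.

Definition lebesgue01 (A : set unitIco) : \bar R :=
  lebesgue_measure (unitIco_val @` A).

Let lebesgue01_set0 : lebesgue01 set0 = 0%E.
Proof. by rewrite /lebesgue01 image_set0 measure0. Qed.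

Let lebesgue01_ge0 A : (0 <= lebesgue01 A)%E.
Proof. exact: measure_ge0. Qed.

Let lebesgue01_sigma_additive : semi_sigma_additive lebesgue01.
Proof.
move=> F mF tF mUF; rewrite /lebesgue01 image_bigcup.
apply: measure_semi_sigma_additive.
- by move=> i; exact: measurable_image_unitIco_val.
- apply/trivIsetP => i j _ _ ij.
  have /trivIsetP /(_ i j I I ij) Fij := tF.
  apply/seteqP; split => // _ [[x Fx <-] [y Fy /unitIco_val_inj yx]].
  by suff : set0 x by []; rewrite -Fij; split => //; rewrite -yx.
- by rewrite -image_bigcup; exact: measurable_image_unitIco_val.
Qed.

HB.instance Definition _ := isMeasure.Build _ _ _ lebesgue01
  lebesgue01_set0 lebesgue01_ge0 lebesgue01_sigma_additive.

Let lebesgue01_setT : lebesgue01 [set: unitIco] = 1%E.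
Proof.
by rewrite /lebesgue01 range_unitIco_val lebesgue_measure_itv/= lte01 sube0.
Qed.

HB.instance Definition _ := Measure_isProbability.Build _ _ _ lebesgue01
  lebesgue01_setT.

(** Takes the value 0 (instead of 1 or -1) at the multiples of [2 ^- k]. *)
Definition rademacher (k : nat) (x : unitIco) : R :=
  Num.sg (sin (2 ^+ k * pi * unitIco_val x)).

Definition dyadic_partition (k : nat) : set (set unitIco) :=
  [set V | exists2 j, (1 <= j <= 2 ^ k)%N &
    V = [set x | unitIco_val x \in `[j.-1%:R / 2 ^+ k, j%:R / 2 ^+ k[]].

End unit_interval.

Arguments lebesgue01 {R}.
Arguments rademacher {R}.
Arguments dyadic_partition R : clear implicits.

(* Main.v *)
(* Write T_a g x = (g (x + a) + g (x - a)) / 2, so that iterating T_a averages g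
   over random signs of size a.  For g = |.|^p with p >= 3 the convexity of
   |.|^(p - 2) makes G' z / z nondecreasing, where G z = g (x + z) + g (x - z);
   hence T_a (T_b g) increases when a and b get closer with a^2 + b^2 fixed,
   and among all sign averages with a given sum of squared coefficients the one
   with equal coefficients is largest.  On a block of D_(k-1) convexity bounds
   the average of g (x + d_k) by T_a g x with a = ||1_V d_k||_oo, because d_k has
   mean zero there.  A backward induction on k, always spreading the unused part
   of ||S(d)||_oo^2 equally over the remaining steps, gives the bound by
   (T_(s / sqrt n))^n g at 0, which is the p-th moment of the normalized
   Rademacher sum times s^p. *)

Require Import Defs.
From HB Require Import structures.
From mathcomp Require Import all_boot all_order all_algebra.
From mathcomp Require Import all_classical all_reals all_analysis.
From mathcomp Require Import measurable_realfun ess_sup_inf.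
From mathcomp Require Import ring lra.

Set Implicit Arguments.
Unset Strict Implicit.
Unset Printing Implicit Defensive.

Import Order.TTheory GRing.Theory Num.Theory.
Import numFieldNormedType.Exports.

Local Open Scope classical_set_scope.
Local Open Scope ring_scope.

(** * Averaging over a random sign: convexity, commutation and balancing of coefficients *)

Section two_point_average.
Context {R : realType}.
Implicit Types (f g : R -> R) (a b x y : R).

Definition two_point a g : R -> R := fun x => (g (x + a) + g (x - a)) / 2.

Definition convexR g := forall t x y, 0 <= t <= 1 ->
  g (t * x + (1 - t) * y) <= t * g x + (1 - t) * g y.

(* The two-coefficient case of: [E g (x + \sum_k a_k r_k)] is Schur-concave in
   the squares of the coefficients. *)
Definition balancing g := forall x a b a' b',
  0 <= a -> 0 <= b -> 0 <= a' -> 0 <= b' ->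
  a ^+ 2 + b ^+ 2 = a' ^+ 2 + b' ^+ 2 -> a * b <= a' * b' ->
  two_point a (two_point b g) x <= two_point a' (two_point b' g) x.

Lemma two_point_ge0 a g : (forall x, 0 <= g x) -> forall x, 0 <= two_point a g x.
Proof. by move=> g0 x; rewrite divr_ge0// addr_ge0. Qed.

Lemma le_two_point a f g :
  (forall x, f x <= g x) -> forall x, two_point a f x <= two_point a g x.
Proof. by move=> fg x; rewrite ler_pM2r// lerD. Qed.

Lemma two_pointC a b g : two_point a (two_point b g) = two_point b (two_point a g).
Proof.
apply/funext => x; rewrite /two_point.
rewrite (_ : x + a + b = x + b + a); last by ring.
rewrite (_ : x + a - b = x - b + a); last by ring.
rewrite (_ : x - a + b = x + b - a); last by ring.
rewrite (_ : x - a - b = x - b - a); last by ring.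
by field.
Qed.

Lemma convexR_two_point a g : convexR g -> convexR (two_point a g).
Proof.
move=> cg t x y t01; rewrite /two_point.
have := cg t (x + a) (y + a) t01; have := cg t (x - a) (y - a) t01.
rewrite (_ : t * (x - a) + (1 - t) * (y - a) = t * x + (1 - t) * y - a); last by ring.
rewrite (_ : t * (x + a) + (1 - t) * (y + a) = t * x + (1 - t) * y + a); last by ring.
lra.
Qed.

(** Averages commute, so [two_point a] can be moved outermost, where it preserves pointwise
    inequalities. *)
Lemma balancing_two_point a g : balancing g -> balancing (two_point a g).
Proof.
move=> sg x b c b' c' b0 c0 b'0 c'0 e le.
by rewrite ![two_point _ (two_point a g)]two_pointC ![two_point _ (two_point a _)]two_pointC;
  apply: le_two_point => y; exact: sg.
Qed.

(** A convex function lies below its chord over [[x - d, x + d]]. The chord is written as midpoint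
    value plus slope times [y], so that the second term vanishes on averaging over a mean-zero [y].
    If [d = 0], then [y = 0] and the slope is multiplied by zero. *)
Lemma le_two_point_chord g x y d : convexR g -> `|y| <= d ->
  g (x + y) <= two_point d g x + (g (x + d) - g (x - d)) / (2 * d) * y.
Proof.
move=> cg; have [->|d0 yd] := eqVneq d 0.
  by rewrite normr_le0 => /eqP ->; rewrite /two_point addr0 subr0; lra.
have {}d0 : 0 < d by rewrite lt_neqAle eq_sym d0 (le_trans _ yd).
move: yd; rewrite ler_norml => /andP[yd1 yd2].
have := cg ((1 + y / d) / 2) (x + d) (x - d).
have e : y / d <= 1 by rewrite ler_pdivrMr ?mul1r.
have e' : - 1 <= y / d by rewrite ler_pdivlMr ?mulN1r.
rewrite (_ : _ + (1 - (1 + y / d) / 2) * (x - d) = x + y); last by field; lra.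
move=> /(_ ltac:(lra)) /le_trans; apply.
by rewrite /two_point le_eqVlt; apply/orP; left; apply/eqP; field; lra.
Qed.

(** The chord bound over [[x - b, x + b]] is taken at [y = a] and [y = - a]; the linear terms cancel
    in the average. *)
Lemma ler_two_point g x a b : convexR g -> 0 <= a -> a <= b ->
  two_point a g x <= two_point b g x.
Proof.
move=> cg a0 ab.
have := @le_two_point_chord g x a b cg; have := @le_two_point_chord g x (- a) b cg.
rewrite normrN ger0_norm// => /(_ ab) + /(_ ab).
rewrite {3}/two_point; lra.
Qed.

Lemma convexR_iter_two_point n a g : convexR g -> convexR (iter n (two_point a) g).
Proof. by move=> cg; elim: n => // n IH; exact: convexR_two_point. Qed.

Lemma balancing_iter_two_point n a g :
  balancing g -> balancing (iter n (two_point a) g).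
Proof. by move=> cg; elim: n => // n IH; exact: balancing_two_point. Qed.

Lemma iter_two_point_ge0 n a g : (forall x, 0 <= g x) ->
  forall x, 0 <= iter n (two_point a) g x.
Proof. by move=> cg; elim: n => // n IH; exact: two_point_ge0. Qed.

(** The all-plus choice of signs alone already contributes a positive term. *)
Lemma iter_two_point_gt0 n a g x : (forall y, 0 <= g y) ->
  0 < g (x + n%:R * a) -> 0 < iter n (two_point a) g x.
Proof.
move=> g0; elim: n x => [x|n IH x]; first by rewrite mul0r addr0.
rewrite (_ : x + n.+1%:R * a = x + a + n%:R * a) => [gt|]; last by rewrite -natr1; ring.
by rewrite divr_gt0// ltr_pwDl//; [exact: IH | exact: iter_two_point_ge0].
Qed.

(* Each step moves one coefficient to the common value [c], keeping the sum of
   squares; [u] absorbs the difference. *)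
Lemma le_two_point_iter g m u b c x : balancing g -> 0 <= u -> 0 <= b -> 0 <= c ->
  u ^+ 2 + m%:R * b ^+ 2 = m.+1%:R * c ^+ 2 ->
  two_point u (iter m (two_point b) g) x <= iter m.+1 (two_point c) g x.
Proof.
move=> sg + b0 c0; elim: m u x => [|m IH] u x u0 e.
  suff -> : u = c by [].
  by apply/eqP; rewrite -(eqrXn2 (n := 2))//; apply/eqP; move: e; rewrite mul0r addr0 mul1r.
have v0 : 0 <= u ^+ 2 + b ^+ 2 - c ^+ 2.
  have -> : u ^+ 2 + b ^+ 2 - c ^+ 2 = m.+1%:R * c ^+ 2 - m%:R * b ^+ 2.
    by move: e; rewrite -!natr1; lra.
  have m0 : 0 <= m%:R :> R by [].
  have : m.+1%:R * b ^+ 2 <= m.+2%:R * c ^+ 2 by have := sqr_ge0 u; lra.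
  rewrite -!natr1 => h; rewrite subr_ge0.
  (* After multiplication by [m + 1], the claim reduces to [(m + 1)^2 - m (m + 2) = 1 >= 0]. *)
  rewrite -(ler_pM2l (x := m%:R + 1)); last by lra.
  have := sqr_ge0 c; have := sqr_ge0 b; nra.
(* The pair [(u, b)] is exchanged for [(c, v)] with the same sum of squares; [v] then takes the
   place of [u] in the induction. *)
set v := Num.sqrt (u ^+ 2 + b ^+ 2 - c ^+ 2).
have v2 : v ^+ 2 = u ^+ 2 + b ^+ 2 - c ^+ 2 by rewrite sqr_sqrtr.
apply: (@le_trans _ _ (two_point c (two_point v (iter m (two_point b) g)) x)).
  apply: (balancing_iter_two_point _ _ sg) => //; [exact: sqrtr_ge0|lra|].
  (* Since [c ^+ 2] is a weighted mean of [u ^+ 2] and [b ^+ 2], the difference of the squared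
     products is [m.+1 * (c ^+ 2 - b ^+ 2) ^+ 2]. *)
  rewrite -(ler_pXn2r (n := 2)) ?nnegrE ?mulr_ge0 ?sqrtr_ge0//.
  rewrite !exprMn v2 -subr_ge0 mulrC (mulrC (u ^+ 2)).
  have -> : (u ^+ 2 + b ^+ 2 - c ^+ 2) * c ^+ 2 - b ^+ 2 * u ^+ 2 =
    (u ^+ 2 - c ^+ 2) * (c ^+ 2 - b ^+ 2) by ring.
  have -> : u ^+ 2 - c ^+ 2 = m.+1%:R * (c ^+ 2 - b ^+ 2).
    by move: e; rewrite -!natr1; lra.
  by rewrite -mulrA mulr_ge0// -expr2 sqr_ge0.
apply: le_two_point => y; apply: IH; first exact: sqrtr_ge0.
by move: e; rewrite v2 -!natr1; lra.
Qed.

End two_point_average.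

(** * Derivatives of powers, and the balancing property of [|w| ^ p] for [p >= 3] *)

Section power_balancing.
Context {R : realType}.
Implicit Types (p q x y z w : R).

Lemma ge0_is_derive_le (f df : R -> R) (a b : R) : a <= b ->
  (forall x, is_derive x 1 f (df x)) ->
  (forall x, a < x < b -> 0 <= df x) -> f a <= f b.
Proof.
rewrite le_eqVlt => /predU1P[->//|ab] fdf df0.
have [|c] := @MVT R f df a b ab (fun x _ => fdf x).
  by apply: derivable_within_continuous => x _; apply: ex_derive; exact: fdf.
rewrite in_itv/= => /df0 df0c e; rewrite -subr_ge0 e mulr_ge0// subr_ge0 ltW//.
Qed.

(** The difference quotient at 0 is at most [|h| ^ (q - 1)], which tends to 0. This covers the
    origin, where [|w|] itself has no derivative. *)
Lemma is_derive0_powR_bound q (g : R -> R) : 1 < q ->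
  (forall x, `|g x| <= `|x| `^ q) -> is_derive (0 : R) 1 g 0.
Proof.
move=> q1 gq.
have g0 : g 0 = 0.
  apply/eqP; rewrite -normr_le0 (le_trans (gq 0))// normr0 powR0//; lra.
have cv : (fun h : R => h^-1 *: ((g \o shift (0:R)) (h *: 1) - g 0)) @ 0^' --> (0 : R).
  apply/cvgrPdist_lt => e e0.
  have := @powR_cvg0 R (q - 1) ltac:(lra) => /cvgrPdist_lt /(_ e e0).
  rewrite near_withinE => -[d /= d0 hd]; exists d => // h /= hd' h0.
  rewrite sub0r normrN g0 subr0 addr0 [h *: 1]mulr1 normrM normfV.
  have nh0 : 0 < `|h| by rewrite normr_gt0.
  rewrite mulrC ltr_pdivrMr//; apply: (le_lt_trans (gq h)).
  rewrite -mulr_powRB1 ?normr_ge0//; last by lra.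
  rewrite mulrC ltr_pM2r//.
  have := hd `|h|; rewrite /= !sub0r !normrN normr_id => /(_ _ nh0).
  rewrite sub0r normrN in hd' => /(_ hd').
  by rewrite ger0_norm// powR_ge0.
apply: DeriveDef; first by apply/cvg_ex; exists 0.
exact: cvg_lim cv.
Qed.

(** Up to a constant factor, the derivative of the power of [|w|] with exponent [q + 1]. *)
Definition signed_powR q w := Num.sg w * `|w| `^ q.

Lemma is_derive_abs_powR p x : 1 < p ->
  is_derive x 1 (fun w => `|w| `^ p) (p * signed_powR (p - 1) x).
Proof.
rewrite /signed_powR => p1; case: (ltgtP x 0) => [x0|x0|->].
- rewrite ltr0_sg// mulN1r mulrN -mulrN1 ltr0_norm//.
  apply: (@near_eq_is_derive _ _ _ ((@powR R ^~ p) \o -%R)).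
    by near=> y; rewrite /= ltr0_norm//; near: y; exact: lt_nbhsl.
  apply: is_derive1_comp; apply: is_derive1_powR; lra.
- rewrite gtr0_sg// mul1r gtr0_norm//.
  apply: (@near_eq_is_derive _ _ _ (@powR R ^~ p)).
    by near=> y; rewrite /= gtr0_norm//; near: y; exact: lt_nbhsr.
  exact: is_derive1_powR.
- rewrite sgr0 mul0r mulr0; apply: (@is_derive0_powR_bound p) => // y.
  by rewrite ger0_norm// powR_ge0.
Unshelve. all: by end_near. Qed.

Lemma is_derive_signed_powR q x : 1 < q ->
  is_derive x 1 (signed_powR q) (q * `|x| `^ (q - 1)).
Proof.
move=> q1; case: (ltgtP x 0) => [x0|x0|->].
- rewrite ltr0_norm//.
  apply: (@near_eq_is_derive _ _ _ (- ((@powR R ^~ q) \o -%R))).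
    near=> y; have y0 : y < 0 by near: y; exact: lt_nbhsl.
    by rewrite fctE /signed_powR /= ltr0_norm// ltr0_sg// mulN1r.
  rewrite -[X in is_derive _ _ _ X]opprK; apply: is_deriveN.
  rewrite -[X in is_derive _ _ _ X]mulrN1; apply: is_derive1_comp.
  apply: is_derive1_powR; lra.
- rewrite gtr0_norm//.
  apply: (@near_eq_is_derive _ _ _ (@powR R ^~ q)).
    near=> y; have y0 : 0 < y by near: y; exact: lt_nbhsr.
    by rewrite /signed_powR gtr0_norm// gtr0_sg// mul1r.
  exact: is_derive1_powR.
- rewrite normr0 powR0 ?mulr0; last by lra.
  apply: (@is_derive0_powR_bound q) => // y.
  rewrite normrM (ger0_norm (powR_ge0 _ _)) normr_sg.
  by rewrite ler_piMl ?powR_ge0// lern1 leq_b1.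
Unshelve. all: by end_near. Qed.

Lemma convexR_abs_powR p : 1 <= p -> convexR (fun w : R => `|w| `^ p).
Proof.
move=> p1 t x y /andP[t0 t1].
apply: (@le_trans _ _ ((t * `|x| + (1 - t) * `|y|) `^ p)).
  have t1' : 0 <= 1 - t by lra.
  have p0 : 0 <= p by lra.
  apply: ge0_ler_powR; rewrite ?nnegrE ?addr_ge0 ?mulr_ge0//.
  by rewrite (le_trans (ler_normD _ _))// !normrM (ger0_norm t0) (ger0_norm t1').
by apply: (convex_powR p1 (Itv01 t0 t1)) => //=;
  rewrite ?inE/= ?in_itv/= ?normr_ge0.
Qed.

Lemma is_derive_affine (x c w : R) : is_derive w 1 (fun w => x + c * w) c.
Proof.
have h : is_derive w (1 : R) (cst x + c *: (id : R -> R)) (0 + c *: (1 : R)).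
  apply: is_deriveD; apply: is_deriveZ.
by rewrite add0r [c *: (1 : R)]mulr1 in h.
Qed.

(** This is the monotonicity of [G' z / z]. With [l = y / z], the auxiliary [h] vanishes at 0, and
    [h' w] is [2 * l * q] times the gap between the two-point averages of [|.| ^ (q - 1)] at sizes
    [w] and [l * w]. As [q - 1 >= 1], that power is convex and the gap is nonnegative. *)
Lemma signed_powR_slope q x y z : 2 <= q -> 0 < y -> y <= z ->
  (signed_powR q (x + y) - signed_powR q (x - y)) / y <=
  (signed_powR q (x + z) - signed_powR q (x - z)) / z.
Proof.
move=> q2 y0 yz; set k := signed_powR q.
have z0 : 0 < z by lra.
pose l := y / z.
have l01 : 0 < l <= 1 by rewrite divr_gt0// ler_pdivrMr// mul1r.
pose h w := l * (k (x + w) - k (x - w)) - (k (x + l * w) - k (x - l * w)).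
pose k' w := q * `|w| `^ (q - 1).
pose dh w := l * (k' (x + w) + k' (x - w)) - l * (k' (x + l * w) + k' (x - l * w)).
have kD w : is_derive w 1 k (k' w) by apply: is_derive_signed_powR; lra.
have kaD c w : is_derive w 1 (k \o (fun w => x + c * w)) (k' (x + c * w) * c).
  by apply: is_derive1_comp; exact: is_derive_affine.
have hD w : is_derive w 1 h (dh w).
  have -> : h = l *: ((k \o (fun w => x + 1 * w)) - (k \o (fun w => x + (- 1) * w)))
     - ((k \o (fun w => x + l * w)) - (k \o (fun w => x + (- l) * w))).
    by apply/funext => v; rewrite /h !fctE /= mul1r mulN1r mulNr.
  apply: is_derive_eq; rewrite /dh mul1r mulN1r mulNr [_ *: _]mulrC; ring.
have : h 0 <= h z.
  apply: (ge0_is_derive_le (ltW z0) hD) => w /andP[w0 wz].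
  rewrite /dh -mulrBr mulr_ge0//; first by lra.
  have := @ler_two_point _ _ x (l * w) w (@convexR_abs_powR (q - 1) ltac:(lra)).
  have lw0 : 0 <= l * w by rewrite mulr_ge0//; lra.
  have lww : l * w <= w by rewrite ler_piMl//; lra.
  move=> /(_ lw0 lww); rewrite /two_point ler_pM2r// => le.
  by rewrite /k' subr_ge0 -!mulrDr ler_pM2l//; lra.
rewrite /h mulr0 oppr0 !addr0 !subrr mulr0 subr0 subr_ge0 => kl.
have lz : l * z = y by rewrite /l mulfVK// gt_eqF.
move: kl; rewrite lz => kl.
by rewrite ler_pdivrMr// (le_trans kl)// /l mulrAC -mulrA mulrC.
Qed.

(** A double average depends only on [G (a + b) + G (a - b)]. Once each pair is ordered, passing to
    [a', b'] raises the sum and lowers the difference while the sum of their squares stays fixed. *)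
Lemma balancing_abs_powR p : 3 <= p -> balancing (fun w : R => `|w| `^ p).
Proof.
move=> p3 x a b a' b'; set f := fun w : R => _.
wlog ba : a b / b <= a.
  move=> wl a0 b0 a'0 b'0; have [ba|/ltW ab] := leP b a; first exact: wl.
  by rewrite (two_pointC a b) addrC (mulrC a); exact: wl.
wlog ba' : a' b' / b' <= a'.
  move=> wl a0 b0 a'0 b'0; have [ba'|/ltW ab'] := leP b' a'; first exact: wl.
  by rewrite (two_pointC a' b') (addrC (a' ^+ 2)) (mulrC a'); exact: wl.
move=> a0 b0 a'0 b'0 ss ab.
pose k := signed_powR (p - 1).
pose G z := f (x + z) + f (x - z).
pose dG z := p * (k (x + z) - k (x - z)).
have fD w : is_derive w 1 f (p * k w) by apply: is_derive_abs_powR; lra.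
have faD c w : is_derive w 1 (f \o (fun w => x + c * w)) (p * k (x + c * w) * c).
  by apply: is_derive1_comp; exact: is_derive_affine.
have GE : two_point a (two_point b f) x = (G (a + b) + G (a - b)) / 4.
  rewrite /two_point /G.
  rewrite (_ : x - (a + b) = x - a - b); last by ring.
  rewrite (_ : x - (a - b) = x - a + b); last by ring.
  by rewrite !addrA; field.
have GE' : two_point a' (two_point b' f) x = (G (a' + b') + G (a' - b')) / 4.
  rewrite /two_point /G.
  rewrite (_ : x - (a' + b') = x - a' - b'); last by ring.
  rewrite (_ : x - (a' - b') = x - a' + b'); last by ring.
  by rewrite !addrA; field.
rewrite GE GE' ler_pM2r//.
have QQ : a' - b' <= a - b.
  by rewrite -(ler_pXn2r (n := 2)) ?nnegrE ?subr_ge0// !sqrrB; lra.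
have PP : a + b <= a' + b'.
  by rewrite -(ler_pXn2r (n := 2)) ?nnegrE ?addr_ge0// !sqrrD; lra.
set Q := a - b in QQ *.
(* When [a = b] the difference cannot decrease, so both pairs coincide; this case is separated
   because [C] divides by [Q]. *)
have [Q0|Q0] := eqVneq Q 0.
  have Q'0 : a' - b' = 0 by apply/eqP; rewrite eq_le subr_ge0 ba' andbT -Q0.
  suff -> : a' + b' = a + b by rewrite Q0 Q'0.
  have bb' : b' = a' by lra.
  have bb : b = a by rewrite /Q in Q0; lra.
  suff aa' : a' = a by rewrite bb' bb aa'.
  move: ss; rewrite bb bb' => ss.
  by apply/eqP; rewrite -(eqrXn2 (n := 2))//; apply/eqP; lra.
have {}Q0 : 0 < Q by rewrite lt_neqAle eq_sym Q0 subr_ge0.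
(* This constant makes [dL Q = 0]. As [dG z / z] is nondecreasing, [L] then decreases up to [Q] and
   increases after it, so lowering the difference and raising the sum both increase [L]. *)
pose C := dG Q / (2 * Q).
pose L z := G z - C * z ^+ 2.
pose dL z := dG z - C * (2 * z).
have LD w : is_derive w 1 L (dL w).
  have -> : L = (f \o (fun w => x + 1 * w)) + (f \o (fun w => x + (- 1) * w))
     - C *: (id ^+ 2).
    by apply/funext => v; rewrite /L /G !fctE /= mul1r mulN1r.
  apply: is_derive_eq; rewrite /dL /dG mul1r mulN1r expr1 /GRing.scale /=; ring.
have dGlow z : 0 < z <= Q -> dL z <= 0.
  move=> /andP[z0 zQ].
  have := @signed_powR_slope (p - 1) x z Q ltac:(lra) z0 zQ; rewrite -!/k => sl.
  rewrite /dL /C /dG.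
  rewrite (_ : _ - _ = p * (z * ((k (x + z) - k (x - z)) / z - (k (x + Q) - k (x - Q)) / Q))).
    by rewrite !mulr_ge0_le0// ?subr_le0//; lra.
  by field; rewrite !gt_eqF.
have dGup z : Q <= z -> 0 <= dL z.
  move=> zQ.
  have := @signed_powR_slope (p - 1) x Q z ltac:(lra) Q0 zQ; rewrite -!/k => sl.
  rewrite /dL /C /dG.
  rewrite (_ : _ - _ = p * (z * ((k (x + z) - k (x - z)) / z - (k (x + Q) - k (x - Q)) / Q))).
    by rewrite !mulr_ge0// ?subr_ge0//; lra.
  by field; rewrite !gt_eqF// (lt_le_trans Q0).
have L1 : L Q <= L (a' - b').
  rewrite -lerN2; apply: (@ge0_is_derive_le (- L) (- dL)) => //.
  by move=> z /andP[z1 z2]; rewrite fctE oppr_ge0 dGlow// (ltW z2) (le_lt_trans _ z1)// subr_ge0.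
have L2 : L (a + b) <= L (a' + b').
  apply: (@ge0_is_derive_le L dL) => // z /andP[z1 z2]; apply: dGup.
  by rewrite (le_trans _ (ltW z1))// /Q; lra.
(* The subtracted quadratic terms agree on both sides, so the inequalities for [L] add up to the one
   for [G]. *)
have : C * (Q ^+ 2 + (a + b) ^+ 2) = C * ((a' - b') ^+ 2 + (a' + b') ^+ 2).
  by congr (_ * _); rewrite /Q; lra.
move: L1 L2; rewrite /L; lra.
Qed.

End power_balancing.

(** * Countable partitions, functions constant on their blocks, and integration block by block *)

Section countable_partition.
Context {T : Type}.
Variable D : set (set T).
Hypothesis pD : partition D id [set: T].

(** Pointwise substitute for measurability with respect to the generated sigma-algebra. The target
    is arbitrary so that [Y := Prop] covers sets and pointwise properties. *)
Definition constant_on_blocks (Y : Type) (g : T -> Y) :=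
  forall V x y, D V -> V x -> V y -> g x = g y.

Lemma partition_block x : exists2 V, D V & V x.
Proof. by case: pD => cD _ _; have : [set: T] x by []; rewrite -cD => -[V]; exists V. Qed.

Lemma partition_block_eq V W x : D V -> D W -> V x -> W x -> V = W.
Proof. by case: pD => _ tD _ DV DW Vx Wx; apply: tD => //; exists x. Qed.

(** The sets that contain a whole block as soon as they contain one of its points form a
    sigma-algebra, and it includes [D]. *)
Lemma sigma_algebra_block A V x y : <<s D >> A -> D V -> V x -> V y -> A x -> A y.
Proof.
pose G := [set A : set T | forall V x y, D V -> V x -> V y -> A x -> A y].
suff /[apply] : <<s D >> `<=` G by apply.
apply: smallest_sub => [|W DW U a b DU Ua Ub Wa]; last first.
  by rewrite (partition_block_eq DW DU Wa Ua).
split => [//|B GB U a b DU Ua Ub [_ Ba]|F GF U a b DU Ua Ub [i _ Fi]].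
- by split=> // Bb; apply: Ba; apply: GB Bb; eassumption.
- by exists i => //; apply: GF Fi; eassumption.
Qed.

Hypothesis cD : countable D.

Lemma countable_partition_enum : exists F : (set T)^nat,
  [/\ forall i, F i = set0 \/ D (F i), trivIset setT F & \bigcup_i F i = setT].
Proof.
have /countable_injP[f finj] := cD.
exists (fun i => \bigcup_(V in [set V | D V /\ f V = i]) V); split.
- move=> i; have [[V [DV fV]]|nV] := pselect (exists V, D V /\ f V = i); [right|left].
    suff -> : [set V | D V /\ f V = i] = [set V] by rewrite bigcup_set1.
    apply/seteqP; split => [W [DW fW]|W ->]; last by split.
    by apply: finj; rewrite ?inE// fV fW.
  by rewrite -subset0 => x [V [DV fV]] _; apply: nV; exists V.
- apply/trivIsetP => i j _ _ /eqP ij; rewrite -subset0 => x [[V [DV fV] Vx] [W [DW fW] Wx]].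
  by apply: ij; rewrite -fV -fW (partition_block_eq DV DW Vx Wx).
- apply/seteqP; split => // x _; have [V DV Vx] := partition_block x.
  by exists (f V) => //; exists V.
Qed.

End countable_partition.

Section countable_measurable_partition.
Context d (X : measurableType d).
Variable D : set (set X).
Hypotheses (pD : partition D id [set: X]) (cD : countable D).
Hypothesis mD : forall V, D V -> measurable V.

Lemma constant_on_blocks_measurable d' (Y : measurableType d') (g : X -> Y) :
  constant_on_blocks D g -> measurable_fun setT g.
Proof.
move=> gD _ B mB; rewrite setTI.
have [F [FD tF cF]] := countable_partition_enum pD cD.
rewrite -(setTI (g @^-1` B)) -cF setI_bigcupl; apply: bigcupT_measurable => i.
have [->|DFi] := FD i; first by rewrite set0I.
have [[x [Fx Bx]]|nx] := pselect (exists x, F i x /\ B (g x)).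
  rewrite (_ : _ `&` _ = F i); first exact: mD.
  by apply/seteqP; split => [y []//|y Fy]; split => //=; rewrite (gD _ _ _ DFi Fy Fx).
rewrite (_ : _ `&` _ = set0)// -subset0 => y [Fy By].
by apply: nx; exists y.
Qed.

Lemma blocks_integral_le (R : realType) (mu : {measure set X -> \bar R})
    (f g : X -> \bar R) :
  (forall x, 0 <= f x)%E -> (forall x, 0 <= g x)%E ->
  measurable_fun [set: X] f -> measurable_fun [set: X] g ->
  (forall V, D V -> \int[mu]_(x in V) f x <= \int[mu]_(x in V) g x)%E ->
  (\int[mu]_x f x <= \int[mu]_x g x)%E.
Proof.
move=> f0 g0 mf mg fg.
have [F [FD tF cF]] := countable_partition_enum pD cD.
have mF i : measurable (F i) by have [->//|/mD] := FD i.
rewrite -cF !ge0_integral_bigcup// ?cF//.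
apply: lee_nneseries => [i _ _|i _]; first exact: integral_ge0.
by have [->|/fg//] := FD i; rewrite !integral_set0.
Qed.

(** One exceptional point would make its whole block exceptional, yet blocks have positive measure.
    This turns essential-supremum bounds into pointwise ones. *)
Lemma ae_constant_on_blocks (R : realType) (mu : {measure set X -> \bar R})
    (P : X -> Prop) :
  (forall V, D V -> 0 < mu V)%E -> constant_on_blocks D P ->
  {ae mu, forall x, P x} -> forall x, P x.
Proof.
move=> muD DP [A [mA A0 PA]] x; apply: contrapT => nPx.
have [V DV Vx] := partition_block pD x.
suff : (mu V <= mu A)%E by rewrite A0 leNgt muD.
rewrite le_measure ?inE//; first exact: mD.
move=> y Vy; apply: PA => /= Py; apply: nPx.
by rewrite (DP _ _ _ DV Vx Vy).
Qed.

End countable_measurable_partition.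

(** * Replacing martingale differences by signs under the integral *)

Section martingale_difference.
Context {R : realType} dd (X : measurableType dd) (mu : probability X R).
Variables (D : nat -> set (set X)) (n : nat) (d : nat -> X -> R).
Hypothesis mds : discrete_mds mu D n d.

Let filt := dmds_filtration mds.

(** A coarse block is a union of finer ones, so a finer block meeting it lies inside it. *)
Lemma filtration_constant (Y : Type) (g : X -> Y) j k : (j <= k)%N ->
  constant_on_blocks (D j) g -> constant_on_blocks (D k) g.
Proof.
move=> jk gj; rewrite -(subnK jk); elim: (k - j)%N => // i IH.
rewrite addSn => W x y DW Wx Wy.
have [V DV Vx] := partition_block (dfilt_partition filt (i + j)) x.
have [C CD VC] := dfilt_refine filt DV.
move: (Vx); rewrite VC => -[W' CW' W'x].
have WW' : W = W'.
  exact: (partition_block_eq (dfilt_partition filt _) DW (CD _ CW') Wx W'x).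
by apply: IH DV Vx _; rewrite VC; exists W => //; rewrite WW'.
Qed.

Lemma mds_constant k : (1 <= k <= n)%N -> constant_on_blocks (D k) (d k).
Proof.
move=> kn V x y DV Vx Vy.
have := @dmds_adapted _ _ _ _ _ _ _ mds _ kn measurableT [set d k x] (measurable_set1 _).
rewrite setTI => mk; symmetry.
exact: (sigma_algebra_block (dfilt_partition filt k) mk DV Vx Vy).
Qed.

Lemma mds_sum_constant k : (k <= n)%N ->
  constant_on_blocks (D k) (fun x => \sum_(1 <= i < k.+1) d i x).
Proof.
move=> kn V x y DV Vx Vy; rewrite !big_nat; apply: eq_bigr => i /andP[i1 ik].
apply: (@filtration_constant _ _ i k) DV Vx Vy => //.
by apply: mds_constant; rewrite i1 (leq_trans _ kn).
Qed.

Lemma filtration_measurable d' (Y : measurableType d') (g : X -> Y) k :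
  constant_on_blocks (D k) g -> measurable_fun setT g.
Proof.
apply: constant_on_blocks_measurable;
  [exact: dfilt_partition filt _|exact: dfilt_countable filt _|].
by move=> V; exact: (dfilt_measurable filt).
Qed.

Lemma filtration_integral_le k (f g : X -> \bar R) :
  (forall x, 0 <= f x)%E -> (forall x, 0 <= g x)%E ->
  measurable_fun [set: X] f -> measurable_fun [set: X] g ->
  (forall V x, D k V -> V x -> \int[mu]_(y in V) f y <= \int[mu]_(y in V) g y)%E ->
  (\int[mu]_x f x <= \int[mu]_x g x)%E.
Proof.
move=> f0 g0 mf mg fg; have [_ _ ne] := dfilt_partition filt k.
apply: (blocks_integral_le (dfilt_partition filt k) (dfilt_countable filt k)) => //.
  by move=> V; exact: (dfilt_measurable filt).
by move=> V DV; have [x Vx] := ne _ DV; exact: fg DV Vx.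
Qed.

Lemma mds_integral_affine k V a c : (1 <= k <= n)%N -> D k.-1 V ->
  (\int[mu]_(x in V) (a + c * d k x)%:E = a%:E * mu V)%E.
Proof.
move=> kn DV; have mV := dfilt_measurable filt DV.
have iV : mu.-integrable V (EFin \o d k).
  exact: integrableS (dmds_integrable mds kn).
under eq_integral do rewrite EFinD EFinM.
rewrite integralD//; last exact: integrableZl.
  by rewrite integralZl// (dmds_integral0 mds kn DV) mule0 adde0 integral_cst.
exact: finite_measure_integrable_cst.
Qed.

(** On a block of [D k.-1], [psi] and [c] are constants and [d k] has mean zero, so the linear
    correction integrates to zero. Arguing per block avoids asking for integrability of [c * d k] on
    the whole space. *)
Lemma mds_integral_step_le k (phi psi c : X -> R) : (1 <= k <= n)%N ->
  (forall x, 0 <= phi x) -> (forall x, 0 <= psi x) ->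
  constant_on_blocks (D k) phi -> constant_on_blocks (D k.-1) psi ->
  constant_on_blocks (D k.-1) c ->
  (forall x, phi x <= psi x + c x * d k x) ->
  (\int[mu]_x (phi x)%:E <= \int[mu]_x (psi x)%:E)%E.
Proof.
move=> kn phi0 psi0 phiD psiD cD le.
have mphi : measurable_fun setT (EFin \o phi).
  by apply/measurable_EFinP; exact: filtration_measurable phiD.
have mpsi : measurable_fun setT (EFin \o psi).
  by apply/measurable_EFinP; exact: filtration_measurable psiD.
have mdk : measurable_fun setT (d k) by exact: filtration_measurable (mds_constant kn).
apply: (@filtration_integral_le k.-1) => //; try by move=> x; rewrite lee_fin.
move=> V x0 DV Vx0; have mV := dfilt_measurable filt DV.
rewrite [leRHS](_ : _ = \int[mu]_(x in V) (psi x0 + c x0 * d k x)%:E)%E; last first.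
  rewrite mds_integral_affine// -integral_cst//.
  by apply: eq_integral => x; rewrite inE => Vx; rewrite (psiD _ _ _ DV Vx Vx0).
have lex x : V x -> phi x <= psi x0 + c x0 * d k x.
  by move=> Vx; rewrite (psiD _ _ _ DV Vx0 Vx) (cD _ _ _ DV Vx0 Vx).
apply: ge0_le_integral => //.
- by move=> x _; rewrite lee_fin.
- exact: measurable_funTS.
- apply/measurable_EFinP; apply: measurable_funTS.
  by apply: measurable_funD => //; apply: measurable_funM.
Qed.

Lemma mds_integral_step_eq k (phi psi c : X -> R) : (1 <= k <= n)%N ->
  (forall x, 0 <= phi x) -> (forall x, 0 <= psi x) ->
  constant_on_blocks (D k) phi -> constant_on_blocks (D k.-1) psi ->
  constant_on_blocks (D k.-1) c ->
  (forall x, phi x = psi x + c x * d k x) ->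
  (\int[mu]_x (phi x)%:E = \int[mu]_x (psi x)%:E)%E.
Proof.
move=> kn phi0 psi0 phiD psiD cD eq.
apply/eqP; rewrite eq_le (mds_integral_step_le kn phi0 psi0 phiD psiD cD) /=; last first.
  by move=> x; rewrite eq.
have mphi : measurable_fun setT (EFin \o phi).
  by apply/measurable_EFinP; exact: filtration_measurable phiD.
have mpsi : measurable_fun setT (EFin \o psi).
  by apply/measurable_EFinP; exact: filtration_measurable psiD.
apply: (@filtration_integral_le k.-1) => //; try by move=> x; rewrite lee_fin.
move=> V x0 DV Vx0; have mV := dfilt_measurable filt DV.
rewrite le_eqVlt; apply/orP; left; apply/eqP.
transitivity (\int[mu]_(x in V) (psi x0 + c x0 * d k x)%:E)%E.
  rewrite mds_integral_affine// -integral_cst//.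
  by apply: eq_integral => x; rewrite inE => Vx; rewrite (psiD _ _ _ DV Vx Vx0).
by apply: eq_integral => x; rewrite inE => Vx;
  rewrite eq (psiD _ _ _ DV Vx0 Vx) (cD _ _ _ DV Vx0 Vx).
Qed.

(* Replaces the differences by independent signs one at a time, from the last to
   the first: given the first [j] of them, the remaining [n - j] increments are
   taken equal in size and share the variance left over. *)
Lemma mds_integral_le (delta : nat -> X -> R) (s : R) (g : R -> R) :
  (forall k, (1 <= k <= n)%N -> constant_on_blocks (D k.-1) (delta k)) ->
  (forall k x, (1 <= k <= n)%N -> `|d k x| <= delta k x) ->
  0 <= s -> (forall x, \sum_(1 <= k < n.+1) delta k x ^+ 2 <= s ^+ 2) ->
  (forall x, 0 <= g x) -> convexR g -> balancing g ->
  (\int[mu]_x (g (\sum_(1 <= k < n.+1) d k x))%:E <=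
   (iter n (two_point (s / Num.sqrt n%:R)) g 0)%:E)%E.
Proof.
move=> deltaD ddelta s0 sums g0 cg bg.
pose S j x := \sum_(1 <= k < j.+1) delta k x ^+ 2.
pose M j x := \sum_(1 <= k < j.+1) d k x.
(* The part of [s ^+ 2] unspent after [j] steps, shared equally by the [n - j] remaining ones. *)
pose A j x := Num.sqrt ((s ^+ 2 - S j x) / (n - j)%:R).
pose phi j x := iter (n - j) (two_point (A j x)) g (M j x).
have phi0 j x : 0 <= phi j x by exact: iter_two_point_ge0.
have S_mono j x : (j <= n)%N -> S j x <= s ^+ 2.
  move=> jn; apply: le_trans (sums x); rewrite (big_cat_nat (n := j.+1))//= lerDl.
  by apply: sumr_ge0 => i _; exact: sqr_ge0.
(* Predictability: the bound for step [j.+1], hence the budget left after it, is already known on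
   the blocks of [D j]. *)
have SD j : (j < n)%N -> constant_on_blocks (D j) (S j.+1).
  move=> jn V x y DV Vx Vy; rewrite /S !big_nat; apply: eq_bigr => i /andP[i1 ij].
  congr (_ ^+ 2); apply: (@filtration_constant _ _ i.-1 j) DV Vx Vy.
    by rewrite -ltnS prednK.
  by apply: deltaD; rewrite i1 (leq_trans _ jn).
have SD' j : (j <= n)%N -> constant_on_blocks (D j) (S j).
  case: j => [_ V x y _ _ _|j jn]; first by rewrite /S !big_geq.
  exact: filtration_constant (SD _ jn).
have phiD j : (j <= n)%N -> constant_on_blocks (D j) (phi j).
  move=> jn V x y DV Vx Vy; rewrite /phi /A (SD' _ jn _ _ _ DV Vx Vy).
  by rewrite /M (mds_sum_constant jn DV Vx Vy).
have step j : (j < n)%N ->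
    (\int[mu]_x (phi j.+1 x)%:E <= \int[mu]_x (phi j x)%:E)%E.
  move=> jn; pose G x := iter (n - j.+1) (two_point (A j.+1 x)) g.
  (* Slope of the chord of [G x] over the range allowed for the next increment. *)
  pose c x := (G x (M j x + delta j.+1 x) - G x (M j x - delta j.+1 x)) /
    (2 * delta j.+1 x).
  have jn' : (1 <= j.+1 <= n)%N by [].
  apply: (@mds_integral_step_le j.+1 (phi j.+1) (phi j) c) => //.
  - exact: phiD.
  - exact/phiD/ltnW.
  - move=> V x y DV Vx Vy; rewrite /c /G /A (SD _ jn _ _ _ DV Vx Vy).
    by rewrite /M (mds_sum_constant (ltnW jn) DV Vx Vy) (deltaD _ jn' _ _ _ DV Vx Vy).
  move=> x; have MS : M j.+1 x = M j x + d j.+1 x by rewrite /M big_nat_recr.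
  have SS : S j.+1 x = S j x + delta j.+1 x ^+ 2 by rewrite /S big_nat_recr.
  have dx := ddelta _ x jn'.
  have delta0 : 0 <= delta j.+1 x by rewrite (le_trans _ dx).
  have SSn : S j.+1 x <= s ^+ 2 by exact: S_mono.
  have Sn : S j x <= s ^+ 2 by apply: S_mono; exact: ltnW.
  rewrite {1}/phi MS -/(G x).
  have cG : convexR (G x) by exact: convexR_iter_two_point.
  apply: (le_trans (le_two_point_chord _ cG dx)); rewrite lerD2r.
  have njS : (n - j)%N = (n - j.+1).+1 by rewrite subnSK.
  rewrite /phi /G.
  have [m0|m0] := posnP (n - j.+1)%N.
    rewrite njS m0 /=; apply: ler_two_point => //.
    rewrite /A njS m0 divr1 -(ger0_norm delta0) -sqrtr_sqr ler_wsqrtr//.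
    by rewrite lerBrDl -SS.
  (* Both sides of the required identity of squares equal [s ^+ 2 - S j x]. *)
  rewrite njS; apply: le_two_point_iter => //; rewrite ?sqrtr_ge0//.
  rewrite !sqr_sqrtr; last 2 first.
  - by rewrite divr_ge0// subr_ge0.
  - by rewrite divr_ge0// subr_ge0.
  rewrite njS SS mulrC divfK ?pnatr_eq0 -?lt0n// [RHS]mulrC divfK ?pnatr_eq0//.
  by ring.
have phin x : phi n x = g (\sum_(1 <= k < n.+1) d k x) by rewrite /phi subnn.
have phi00 x : phi 0%N x = iter n (two_point (s / Num.sqrt n%:R)) g 0.
  by rewrite /phi /A /S /M subn0 !big_geq// subr0 sqrtrM ?sqr_ge0// sqrtr_sqr ger0_norm// sqrtrV.
have le_j j : (j <= n)%N -> (\int[mu]_x (phi j x)%:E <= \int[mu]_x (phi 0%N x)%:E)%E.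
  by elim: j => // j IH jn; apply: (le_trans (step j jn)); exact/IH/ltnW.
have := le_j n (leqnn n).
under eq_integral do rewrite phin.
under [in leRHS]eq_integral do rewrite phi00.
by rewrite integral_cst// [X in (_ * X)%E](_ : _ = 1%E) ?mule1//; exact: probability_setT.
Qed.

(** Each [d k x] is [c] or [- c], an endpoint of the chord, so the chord bound becomes an equality
    for any nonnegative [g], convex or not. *)
Lemma mds_integral_eq (c : R) (g : R -> R) :
  (forall k x, (1 <= k <= n)%N -> `|d k x| = c) -> (forall x, 0 <= g x) ->
  (\int[mu]_x (g (\sum_(1 <= k < n.+1) d k x))%:E =
   (iter n (two_point c) g 0)%:E)%E.
Proof.
move=> dc g0.
pose M j x := \sum_(1 <= k < j.+1) d k x.
pose phi j x := iter (n - j) (two_point c) g (M j x).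
have phiD j : (j <= n)%N -> constant_on_blocks (D j) (phi j).
  by move=> jn V x y DV Vx Vy; rewrite /phi /M (mds_sum_constant jn DV Vx Vy).
have step j : (j < n)%N ->
    (\int[mu]_x (phi j.+1 x)%:E = \int[mu]_x (phi j x)%:E)%E.
  move=> jn; pose G := iter (n - j.+1) (two_point c) g.
  pose a x := (G (M j x + c) - G (M j x - c)) / (2 * c).
  have jn' : (1 <= j.+1 <= n)%N by [].
  apply: (@mds_integral_step_eq j.+1 (phi j.+1) (phi j) a) => //;
    try by move=> x; exact: iter_two_point_ge0.
  - exact: phiD.
  - exact/phiD/ltnW.
  - move=> V x y DV Vx Vy.
    by rewrite /a /M (mds_sum_constant (ltnW jn) DV Vx Vy).
  move=> x; have MS : M j.+1 x = M j x + d j.+1 x by rewrite /M big_nat_recr.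
  rewrite {1}/phi MS -/G /phi -(subnSK jn) iterS -/G /two_point /a.
  have := dc j.+1 x jn'; have [->|c0] := eqVneq c 0.
    by move/eqP; rewrite normr_eq0 => /eqP ->; rewrite addr0 subr0 mulr0 addr0; field.
  have [d0|d0] := leP 0 (d j.+1 x).
    by rewrite ger0_norm// => ->; field.
  by rewrite ltr0_norm// => /(congr1 -%R); rewrite opprK => ->; field.
have le_j j : (j <= n)%N -> (\int[mu]_x (phi j x)%:E = \int[mu]_x (phi 0%N x)%:E)%E.
  by elim: j => // j IH jn; rewrite step// IH// ltnW.
have := le_j n (leqnn n).
rewrite /phi subnn subn0 /M => ->.
under eq_integral do rewrite big_geq//.
by rewrite integral_cst// [X in (_ * X)%E](_ : _ = 1%E) ?mule1//; exact: probability_setT.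
Qed.

End martingale_difference.

(** * Local sup norms and the square function, pointwise and almost everywhere *)

Section square_function_bound.
Context {R : realType} dd (X : measurableType dd) (mu : probability X R).
Variables (D : nat -> set (set X)).
Hypothesis filt : discrete_filtration mu D.

Lemma probability_ess_sup (f : X -> \bar R) :
  'N[mu]_+oo[f]%E = ess_sup mu (abse \o f).
Proof. by rewrite unlock ifT// [ltRHS]probability_setT lte01. Qed.

Lemma local_sup_normE (d : nat -> X -> R) k V x : D k.-1 V -> V x ->
  local_sup_norm mu D d k x = 'N[mu]_+oo[EFin \o (\1_V \* d k)%R]%E.
Proof.
move=> DV Vx; rewrite /local_sup_norm (esumID [set V]); last first.
  by move=> W _; rewrite mule_ge0 ?Lnorm_ge0// lee_fin.
rewrite [X in (_ + X)%E]esum1 ?adde0; last first.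
  move=> W [DW /= nWV]; rewrite indicE memNset ?mule0// => Wx; apply: nWV.
  exact: (partition_block_eq (dfilt_partition filt _) DW DV Wx Vx).
rewrite setIidr; last by move=> _ ->.
by rewrite esum_set1 indicE mem_set// mule1// Lnorm_ge0.
Qed.

Lemma local_sup_norm_ge0 (d : nat -> X -> R) k x : (0 <= local_sup_norm mu D d k x)%E.
Proof. by apply: esum_ge0 => V _; rewrite mule_ge0 ?Lnorm_ge0// lee_fin. Qed.

Lemma local_sup_norm_constant (d : nat -> X -> R) k :
  constant_on_blocks (D k.-1) (local_sup_norm mu D d k).
Proof. by move=> V x y DV Vx Vy; rewrite !(@local_sup_normE _ _ V). Qed.

(** A block has positive measure, so it contains a point where [|d k|] equals [c] and is also below
    its essential supremum. The almost-everywhere hypothesis accommodates the Rademacher functions,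
    which vanish at some dyadic points. *)
Lemma local_sup_norm_ae_cst (d : nat -> X -> R) k (c : R) x :
  {ae mu, forall x, `|d k x| = c} -> local_sup_norm mu D d k x = c%:E.
Proof.
move=> dc; have [V DV Vx] := partition_block (dfilt_partition filt k.-1) x.
rewrite (local_sup_normE _ DV Vx) probability_ess_sup.
have mV := dfilt_measurable filt DV; have V0 := dfilt_gt0 filt DV.
have posP (P : X -> Prop) : {ae mu, forall x, P x} -> exists2 y, V y & P y.
  move=> [A [mA A0 PA]]; apply: contrapT => nVP.
  suff : (mu V <= mu A)%E by rewrite A0 leNgt V0.
  rewrite le_measure ?inE// => y Vy; apply: PA => /= Py.
  by apply: nVP; exists y.
have c0 : 0 <= c by have [y _ <-] := posP _ dc.
apply/eqP; rewrite eq_le; apply/andP; split.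
  apply/ess_supP; apply: filterS dc => y /= dcy.
  rewrite lee_fin normrM dcy indicE; case: (y \in V); last by rewrite normr0 mul0r.
  by rewrite normr1 mul1r.
have /posP[y Vy [dcy]] : {ae mu, forall y, `|d k y| = c /\
    ((abse \o (EFin \o (\1_V \* d k)%R)) y <=
     ess_sup mu (abse \o (EFin \o (\1_V \* d k)%R)))%E}.
  apply: filterS2 dc (ess_sup_ge mu (abse \o (EFin \o (\1_V \* d k)%R))) => y dy hy.
  by split.
by apply: le_trans; rewrite /= normrM dcy indicE mem_set// normr1 mul1r.
Qed.

(** Valid at every point: [d k] and membership in [V] are constant on the blocks of [D k], so an
    almost sure bound has no exceptions. *)
Lemma mds_le_local_sup_norm n (d : nat -> X -> R) k x : discrete_mds mu D n d ->
  (1 <= k <= n)%N -> (`|d k x|%:E <= local_sup_norm mu D d k x)%E.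
Proof.
move=> mds kn; have [V DV Vx] := partition_block (dfilt_partition filt k.-1) x.
rewrite (local_sup_normE _ DV Vx) probability_ess_sup.
suff /(_ x) : forall y, V y -> (`|d k y|%:E <= ess_sup mu (abse \o (EFin \o (\1_V \* d k)%R)))%E
  by exact.
apply: (@ae_constant_on_blocks _ _ (D k) (dfilt_partition filt k) _ _ mu).
- by move=> W; exact: (dfilt_measurable filt).
- by move=> W; exact: (dfilt_gt0 filt).
- move=> W y z DW Wy Wz; rewrite (mds_constant mds kn DW Wy Wz).
  suff -> : V y = V z by [].
  have VD : constant_on_blocks (D k.-1) V.
    move=> U a b DU Ua Ub; apply/propext; split=> Vab.
      by rewrite (partition_block_eq (dfilt_partition filt _) DV DU Vab Ua).
    by rewrite (partition_block_eq (dfilt_partition filt _) DV DU Vab Ub).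
  exact: (filtration_constant mds (leq_pred k) VD DW Wy Wz).
- apply: filterS (ess_sup_ge mu (abse \o (EFin \o (\1_V \* d k)%R))) => y + Vy.
  by apply: le_trans; rewrite /= normrM indicE mem_set// normr1 mul1r.
Qed.

Lemma square_function_le n (d : nat -> X -> R) x : discrete_mds mu D n d ->
  (square_function mu D d n x <= 'N[mu]_+oo[square_function mu D d n])%E.
Proof.
move=> mds; rewrite probability_ess_sup.
apply: (@ae_constant_on_blocks _ _ (D n) (dfilt_partition filt n) _ _ mu
  (fun x => square_function mu D d n x <= _)%E).
- by move=> W; exact: (dfilt_measurable filt).
- by move=> W; exact: (dfilt_gt0 filt).
- move=> W y z DW Wy Wz; suff -> : square_function mu D d n y = square_function mu D d n z by [].
  rewrite /square_function; congr sqrte; rewrite !big_nat; apply: eq_bigr => i /andP[i1 jn].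
  congr (`| _ | ^+ 2)%E.
  apply: (filtration_constant mds _ (@local_sup_norm_constant d i) DW Wy Wz).
  by rewrite (leq_trans (leq_pred i)).
- apply: filterS (ess_sup_ge mu (abse \o square_function mu D d n)) => y.
  by apply: le_trans; rewrite /= lee_abs.
Qed.

Lemma square_function_ae_cst n (d : nat -> X -> R) (c : R) :
  (forall k, (1 <= k <= n)%N -> {ae mu, forall x, `|d k x| = c}) ->
  'N[mu]_+oo[square_function mu D d n]%E = (Num.sqrt (n%:R * c ^+ 2))%:E.
Proof.
move=> dc.
have sE x : square_function mu D d n x = (Num.sqrt (n%:R * c ^+ 2))%:E.
  rewrite /square_function big_nat (eq_bigr (fun=> (c ^+ 2)%:E)); last first.
    move=> i /dc dci; rewrite (local_sup_norm_ae_cst _ dci) /= -EFinM -normrM.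
    by rewrite -expr2 ger0_norm ?sqr_ge0.
  rewrite -big_nat sumEFin sumr_const_nat subn1 /= mulr_natl//.
rewrite probability_ess_sup (_ : _ \o _ = cst (Num.sqrt (n%:R * c ^+ 2))%:E).
  by rewrite ess_sup_cst// [ltRHS]probability_setT lte01.
by apply/funext => x; rewrite /= sE /= ger0_norm// sqrtr_ge0.
Qed.

(** One infinite local norm would make the whole sum of squares infinite; hence all are finite and
    the bound passes to real numbers. *)
Lemma local_sup_norm_sq_le n (d : nat -> X -> R) (s : R) x :
  (square_function mu D d n x <= s%:E)%E ->
  \sum_(1 <= k < n.+1) fine (local_sup_norm mu D d k x) ^+ 2 <= s ^+ 2 /\
  forall k, (1 <= k <= n)%N -> local_sup_norm mu D d k x \is a fin_num.
Proof.
move=> sq; have s0 : 0 <= s by rewrite -lee_fin (le_trans _ sq)// sqrte_ge0.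
have le : (\sum_(1 <= k < n.+1) `|local_sup_norm mu D d k x| ^+ 2 <= (s ^+ 2)%:E)%E.
  by rewrite -lee_sqrt ?lee_fin ?sqr_ge0//= sqrtr_sqr ger0_norm.
have fin k : (1 <= k <= n)%N -> local_sup_norm mu D d k x \is a fin_num.
  move=> kn; rewrite ge0_fin_numE ?local_sup_norm_ge0//.
  rewrite ltNge leye_eq; apply/eqP => lk.
  suff : (+oo <= (s ^+ 2)%:E)%E by rewrite leye_eq.
  apply: le_trans le; rewrite (bigD1_seq k) ?iota_uniq ?mem_index_iota//=.
  rewrite lk /= mulyy addye// gt_eqF// (lt_le_trans (ltNye 0))//.
  by apply: sume_ge0 => i _; rewrite sqre_ge0.
split => //; rewrite -lee_fin (le_trans _ le)// -sumEFin !big_nat.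
apply: lee_sum => i /fin fi; rewrite gee0_abs ?local_sup_norm_ge0//.
by rewrite -{2}(fineK fi) EFin_expe.
Qed.

End square_function_bound.

(** * The moment bound when the square function has finite sup norm *)

Section moment_bound.
Context {R : realType}.
Implicit Types (p s : R).

Lemma iter_two_point_abs_powRZ p s n (c x : R) : 0 <= s ->
  iter n (two_point (s * c)) (fun w => `|w| `^ p) (s * x) =
  s `^ p * iter n (two_point c) (fun w => `|w| `^ p) x.
Proof.
move=> s0; elim: n x => [x|n IH x] /=; first by rewrite normrM ger0_norm// powRM.
by rewrite /two_point -mulrDr -mulrBr !IH; field.
Qed.

Lemma Lnorm_fin d (T : measurableType d) (mu : {measure set T -> \bar R}) p (f : T -> R) :
  ('N[mu]_p%:E[EFin \o f] = (\int[mu]_x (`|f x| `^ p)%:E) `^ p^-1)%E.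
Proof. by rewrite unlock; congr (_ `^ _)%E; apply: eq_integral. Qed.

(** The finite local norms serve as the predictable bounds in [mds_integral_le], with [g] the power
    [|.| ^ p]; homogeneity of that power then extracts the norm of the square function. *)
Lemma mds_Lnorm_le dd (X : measurableType dd) (mu : probability X R)
    (D : nat -> set (set X)) n (d : nat -> X -> R) p : 3 <= p ->
  discrete_mds mu D n d -> 'N[mu]_+oo[square_function mu D d n]%E \is a fin_num ->
  ('N[mu]_p%:E[EFin \o (fun x => \sum_(1 <= k < n.+1) d k x)%R] <=
   (iter n (two_point (Num.sqrt n%:R)^-1) (fun w => `|w| `^ p)%R 0)%:E `^ p^-1 *
   'N[mu]_+oo[square_function mu D d n])%E.
Proof.
move=> p3 mds Nfin; have filt := dmds_filtration mds.
have p0 : 0 < p by lra.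
set N := ('N[mu]_+oo[_])%E in Nfin *; set s := fine N.
have NE : N = s%:E by rewrite fineK.
have s0 : 0 <= s by rewrite fine_ge0// Lnorm_ge0.
have sq x : (square_function mu D d n x <= s%:E)%E by rewrite -NE; exact: square_function_le.
have := @mds_integral_le _ _ _ _ _ _ _ mds (fun k x => fine (local_sup_norm mu D d k x)) s
  (fun w => `|w| `^ p).
have g0 (w : R) : 0 <= `|w| `^ p by exact: powR_ge0.
have p1 : 1 <= p by lra.
move=> /(_ _ _ s0 _ g0 (convexR_abs_powR p1) (balancing_abs_powR p3)) le.
rewrite Lnorm_fin.
apply: (@le_trans _ _ ((iter n (two_point (s / Num.sqrt n%:R)) (fun w => `|w| `^ p)%R 0)%:E `^ p^-1)%E).
  apply: gt0_ler_poweR; first by rewrite invr_ge0 ltW.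
  - by rewrite in_itv /= leey andbT integral_ge0// => x _; rewrite lee_fin.
  - by rewrite in_itv /= leey andbT lee_fin; exact: iter_two_point_ge0.
  apply: le.
  - move=> k kn V x y DV Vx Vy; congr fine.
    exact: (@local_sup_norm_constant _ _ _ _ _ filt d k _ _ _ DV Vx Vy).
  - move=> k x kn; rewrite -lee_fin fineK; first exact: (mds_le_local_sup_norm filt x mds kn).
    by have [_ ->] := local_sup_norm_sq_le (sq x).
  - by move=> x; have [] := local_sup_norm_sq_le (sq x).
have -> : iter n (two_point (s / Num.sqrt n%:R)) (fun w => `|w| `^ p) 0 =
    s `^ p * iter n (two_point (Num.sqrt n%:R)^-1) (fun w => `|w| `^ p) 0.
  by rewrite -iter_two_point_abs_powRZ// mulr0.
rewrite EFinM poweRM ?lee_fin ?powR_ge0//; last exact: iter_two_point_ge0.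
have -> : ((s `^ p)%:E `^ p^-1 = N)%E.
  by rewrite poweR_EFin -powRrM mulfV ?gt_eqF// powRr1.
by rewrite [leLHS]muleC lexx.
Qed.

End moment_bound.

(** * The dyadic filtration and the Rademacher functions on [[0, 1)] *)

Section dyadic_signs.
Context {R : realType}.
Implicit Types (x : unitIco R) (k i : nat).

(** Counts dyadic intervals from 0, whereas [dyadic_partition] counts from 1. Its parity decides the
    sign of the sine. *)
Definition dyadic_index k x : nat := Num.truncn (2 ^+ k * unitIco_val x).

Lemma unitIco_val_itv x : 0 <= unitIco_val x < 1.
Proof. by have := valP x; rewrite in_itv. Qed.

Lemma dyadic_index_itv k x :
  (dyadic_index k x)%:R <= 2 ^+ k * unitIco_val x < (dyadic_index k x).+1%:R.
Proof.
have /andP[x0 _] := unitIco_val_itv x.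
by apply: truncn_itv; rewrite mulr_ge0// exprn_ge0.
Qed.

Lemma dyadic_index_eq k x i :
  i%:R <= 2 ^+ k * unitIco_val x < i.+1%:R -> dyadic_index k x = i.
Proof. exact: truncn_def. Qed.

Lemma dyadic_index_lt k x : (dyadic_index k x < 2 ^ k)%N.
Proof.
have /andP[lo _] := dyadic_index_itv k x; have /andP[_ x1] := unitIco_val_itv x.
by rewrite -(ltr_nat R) (le_lt_trans lo)// natrX -[ltRHS]mulr1 ltr_pM2l ?exprn_gt0.
Qed.

(** Coarsening by one level drops the last binary digit. *)
Lemma dyadic_index_half k x : dyadic_index k x = (dyadic_index k.+1 x)./2.
Proof.
have := dyadic_index_itv k.+1 x; set m := dyadic_index k.+1 x.
rewrite exprS -mulrA => /andP[lo hi]; apply: dyadic_index_eq.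
have natS i : i.+1%:R = i%:R + 1 :> R by rewrite -natr1.
have mE : m%:R = (odd m)%:R + m./2%:R * 2 :> R.
  by rewrite -[in LHS](odd_double_half m) natrD -muln2 natrM.
move: lo hi; rewrite !natS mE.
by case: (odd m) => /= lo hi; apply/andP; split; lra.
Qed.

Definition dyadic_block k i : set (unitIco R) := [set x | dyadic_index k x = i].

Lemma dyadic_partitionE k :
  dyadic_partition R k = [set dyadic_block k i | i in [set i | (i < 2 ^ k)%N]].
Proof.
have k0 : 0 < 2 ^+ k :> R by rewrite exprn_gt0.
have blockE i : dyadic_block k i =
    [set x | unitIco_val x \in `[i%:R / 2 ^+ k, i.+1%:R / 2 ^+ k[].
  apply/seteqP; split => x /=; rewrite in_itv/= ler_pdivrMr// ltr_pdivlMr//.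
    by move=> <-; rewrite mulrC; exact: dyadic_index_itv.
  by rewrite mulrC => /dyadic_index_eq.
apply/seteqP; split => [V [[//|j] /= jk ->]|V [i /= ik <-]].
  by exists j => //; rewrite blockE.
by exists i.+1; rewrite //= blockE.
Qed.

Lemma dyadic_block_partition k i : (i < 2 ^ k)%N ->
  dyadic_partition R k (dyadic_block k i).
Proof. by move=> ik; rewrite dyadic_partitionE; exists i. Qed.

Lemma unitIco_val_block k i : (i < 2 ^ k)%N -> @unitIco_val R @` dyadic_block k i =
  [set` `[i%:R / 2 ^+ k, i.+1%:R / 2 ^+ k[ ].
Proof.
move=> ik; have k0 : 0 < 2 ^+ k :> R by rewrite exprn_gt0.
apply/seteqP; split => [_ [x <- <-]|y] /=; rewrite in_itv/= ler_pdivrMr// ltr_pdivlMr//.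
  by rewrite mulrC; exact: dyadic_index_itv.
move=> /andP[lo hi]; have y01 : y \in `[0, 1[.
  rewrite in_itv/= -(pmulr_lge0 _ k0) (le_trans _ lo)//=.
  rewrite -(ltr_pM2r k0) mul1r (lt_le_trans hi)// -natrX ler_nat//.
exists (exist _ y y01) => //; apply: dyadic_index_eq.
by rewrite /unitIco_val /Ico01_val /= mulrC lo.
Qed.

Lemma measurable_unitIco_preimage (B : set R) : measurable B ->
  measurable ((@unitIco_val R) @^-1` B).
Proof. by move=> mB; exists B => //; rewrite setTI. Qed.

Lemma measurable_dyadic_block k i : (i < 2 ^ k)%N -> measurable (dyadic_block k i).
Proof.
move=> ik.
suff -> : dyadic_block k i = @unitIco_val R @^-1` (@unitIco_val R @` dyadic_block k i).
  by rewrite unitIco_val_block//; exact: measurable_unitIco_preimage.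
apply/seteqP; split => [x xi|x [y yi /unitIco_val_inj <-]//].
by exists x.
Qed.

Lemma lebesgue01_dyadic_block k i : (i < 2 ^ k)%N ->
  lebesgue01 (dyadic_block k i) = ((2 ^+ k)^-1)%:E.
Proof.
move=> ik; rewrite /lebesgue01 unitIco_val_block// lebesgue_measure_itv/= lte_fin.
rewrite ltr_pM2r ?invr_gt0 ?exprn_gt0// ltr_nat ltnSn -EFinB -mulrBl -natrB//.
by rewrite subSnn mul1r.
Qed.

Lemma dyadic_block_split k i : dyadic_block k i =
  dyadic_block k.+1 i.*2 `|` dyadic_block k.+1 i.*2.+1.
Proof.
apply/seteqP; split => x; rewrite /dyadic_block /= (dyadic_index_half k); last first.
  by case=> ->; [rewrite doubleK|rewrite /= uphalf_double].
move=> <-; have := odd_double_half (dyadic_index k.+1 x).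
by case: (odd _) => /= <-; [right|left]; rewrite ?add0n ?add1n /= ?uphalf_double ?doubleK.
Qed.

Lemma dyadic_filtration : discrete_filtration (@lebesgue01 R) (dyadic_partition R).
Proof.
have lt2 k i : (i < 2 ^ k)%N -> (i.*2.+1 < 2 ^ k.+1)%N.
  by move=> ik; rewrite expnS mul2n -doubleS leq_double.
split.
- move=> k; rewrite dyadic_partitionE; split.
  + apply/seteqP; split => // x _; exists (dyadic_block k (dyadic_index k x)) => //.
    by exists (dyadic_index k x) => //=; exact: dyadic_index_lt.
  + by move=> _ _ [i _ <-] [j _ <-] [x [/= <- <-]].
  + move=> _ [i /= ik <-]; apply/set0P/eqP => b0.
    have := lebesgue01_dyadic_block ik; rewrite b0 measure0 => /esym/eqP.
    by rewrite eqe invr_eq0 expf_eq0 pnatr_eq0 andbF.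
- move=> k; rewrite dyadic_partitionE; apply: finite_set_countable; apply: finite_image.
  exact: finite_II.
- by move=> k V; rewrite dyadic_partitionE => -[i ik <-]; exact: measurable_dyadic_block.
- move=> k V; rewrite dyadic_partitionE => -[i ik <-].
  by rewrite [ltRHS]lebesgue01_dyadic_block// lte_fin invr_gt0 exprn_gt0.
- rewrite dyadic_partitionE; apply/seteqP; split => [_ [i /= i1 <-]|_ ->].
    apply/seteqP; split => // x _; rewrite /dyadic_block /=.
    by have := dyadic_index_lt 0 x; case: i i1 => //; case: dyadic_index.
  exists 0%N => //; apply/seteqP; split => // x _; rewrite /dyadic_block /=.
  by have := dyadic_index_lt 0 x; case: dyadic_index.
- move=> k V; rewrite dyadic_partitionE => -[i /= ik <-].
  exists [set dyadic_block k.+1 i.*2; dyadic_block k.+1 i.*2.+1].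
    by move=> _ [->|->]; apply: dyadic_block_partition; rewrite ?lt2// ltnW// lt2.
  by rewrite bigcup_setU !bigcup_set1 dyadic_block_split.
- move=> k; apply: smallest_sub; first exact: smallest_sigma_algebra.
  move=> V; rewrite dyadic_partitionE => -[i /= ik <-].
  rewrite dyadic_block_split; apply: (@measurableU _ (g_sigma_algebraType (dyadic_partition R k.+1)));
   by apply: sub_sigma_algebra; apply: dyadic_block_partition; rewrite ?lt2// ltnW// lt2.
Qed.

(* Coincides with [rademacher k] off the multiples of [2 ^- k]. *)
Definition dyadic_sign k x : R := (-1) ^+ dyadic_index k x.

Lemma dyadic_sign_constant (c : R) k :
  constant_on_blocks (dyadic_partition R k) (fun x => dyadic_sign k x * c).
Proof.
by move=> V x y; rewrite dyadic_partitionE /dyadic_sign => -[i _ <-] -> ->.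
Qed.

Lemma normr_dyadic_sign k x : `|dyadic_sign k x| = 1.
Proof. by rewrite /dyadic_sign normrX normrN1 expr1n. Qed.

Lemma measurable_dyadic_sign (c : R) k :
  measurable_fun [set: unitIco R] (fun x => dyadic_sign k x * c).
Proof.
have filt := dyadic_filtration.
apply: (constant_on_blocks_measurable (dfilt_partition filt k) (dfilt_countable filt k)).
  by move=> V; exact: (dfilt_measurable filt).
exact: dyadic_sign_constant.
Qed.

Lemma dyadic_sign_mds (c : R) n :
  discrete_mds (@lebesgue01 R) (dyadic_partition R) n (fun k x => dyadic_sign k x * c).
Proof.
have filt := dyadic_filtration; split => //.
- move=> k _; apply: (@le_integrable _ _ _ _ _ _ _ (EFin \o cst c)) => //.
  + by apply/measurable_EFinP; exact: measurable_dyadic_sign.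
  + by move=> x _; rewrite /= lee_fin normrM normr_dyadic_sign mul1r.
  + exact: finite_measure_integrable_cst.
- move=> k _.
  apply: (@constant_on_blocks_measurable _ (g_sigma_algebraType (dyadic_partition R k))
    (dyadic_partition R k) (dfilt_partition filt k) (dfilt_countable filt k)).
    by move=> V DV; exact: sub_sigma_algebra.
  exact: dyadic_sign_constant.
- move=> [//|k] _ V /=; rewrite dyadic_partitionE => -[i /= ik <-].
  have lt2 : (i.*2.+1 < 2 ^ k.+1)%N by rewrite expnS mul2n -doubleS leq_double.
  have lt2' := ltnW lt2.
  (* The two halves of the block have equal measure, with sign [1] on the even one and [-1] on the
     odd one. *)
  rewrite dyadic_block_split integral_setU//=.
  + rewrite (eq_integral (cst c%:E)); last first.
      by move=> x; rewrite inE /dyadic_sign => ->; rewrite -signr_odd odd_double mul1r.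
    rewrite (eq_integral (cst (- c)%:E) (D := dyadic_block _ i.*2.+1)); last first.
      by move=> x; rewrite inE /dyadic_sign => ->; rewrite -signr_odd /= odd_double mulN1r.
    rewrite !integral_cst; [|exact: measurable_dyadic_block..].
    rewrite [X in (_ * X + _)%E]lebesgue01_dyadic_block//.
    rewrite [X in (_ + _ * X)%E]lebesgue01_dyadic_block//.
    by rewrite -!EFinM -EFinD mulNr subrr.
  + exact: measurable_dyadic_block.
  + exact: measurable_dyadic_block.
  + by apply/measurable_EFinP; apply: measurable_funTS; exact: measurable_dyadic_sign.
  + apply/disj_setPS => x []; rewrite /dyadic_block /= => -> /eqP.
    by rewrite eq_sym gtn_eqF.
Qed.

Lemma sinD_natpi (y : R) m : sin (y + m%:R * pi) = (-1) ^+ m * sin y.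
Proof.
elim: m => [|m IH]; first by rewrite mul0r addr0 mul1r.
by rewrite -natr1 mulrDl mul1r addrA sinDpi IH exprS mulN1r mulNr.
Qed.

Definition dyadic_points k : set (unitIco R) :=
  [set x | 2 ^+ k * unitIco_val x = (dyadic_index k x)%:R].

(** Splitting [2 ^+ k * x] into its integer part [m] and a remainder [t] in [[0, 1)] gives
    [(-1) ^+ m * sin (t * pi)], whose second factor is positive unless [t = 0]. *)
Lemma rademacherE k x : rademacher k x = dyadic_sign k x * \1_(~` dyadic_points k) x.
Proof.
rewrite /rademacher indicE; have := dyadic_index_itv k x.
set m := dyadic_index k x => /andP[lo hi].
have -> : 2 ^+ k * pi * unitIco_val x = (2 ^+ k * unitIco_val x - m%:R) * pi + m%:R * pi.
  by ring.
rewrite sinD_natpi sgrM /dyadic_sign sgrX sgrN1.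
congr (_ * _); have [e|ne] := pselect (dyadic_points k x).
  rewrite memNset; last by move=> /(_ e).
  by rewrite (e : _ = m%:R) subrr mul0r sin0 sgr0.
rewrite mem_set//= gtr0_sg// sin_gt0_pi// pmulr_lgt0 ?pi_gt0// subr_gt0.
rewrite lt_neqAle lo andbT; apply/andP; split.
  by apply/eqP => e; apply: ne; rewrite /dyadic_points /= -e.
by rewrite gtr_pMl ?pi_gt0// ltrBlDr addrC natr1.
Qed.

Lemma dyadic_points_negligible k :
  measurable (dyadic_points k) /\ lebesgue01 (dyadic_points k) = 0%E.
Proof.
pose B : set R := [set (i%:R / 2 ^+ k) | i in `I_(2 ^ k)].
have k0 : 2 ^+ k != 0 :> R by rewrite expf_neq0.
have fB : finite_set B by apply: finite_image; exact: finite_II.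
have cB : countable B by exact: finite_set_countable.
have mB : measurable B by apply: countable_measurable.
have -> : dyadic_points k = (@unitIco_val R) @^-1` B.
  apply/seteqP; split => x /=.
    rewrite /dyadic_points /= => e; exists (dyadic_index k x); first exact: dyadic_index_lt.
    by rewrite -e mulrC mulKf.
  move=> [i _ e]; rewrite /dyadic_points /=.
  have e' : 2 ^+ k * unitIco_val x = i%:R by rewrite -e mulrC divfK.
  by rewrite e' (@dyadic_index_eq k x i)// e' lexx ltr_nat ltnSn.
split; first exact: measurable_unitIco_preimage.
apply: countable_lebesgue_measure0; apply: sub_countable cB.
by apply: subset_card_le => _ [x Bx <-].
Qed.

Lemma measurable_rademacher k : measurable_fun [set: unitIco R] (rademacher k).
Proof.
rewrite (_ : rademacher k = (fun x => dyadic_sign k x * 1 * \1_(~` dyadic_points k) x)).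
  apply: measurable_funM; first exact: measurable_dyadic_sign.
  by apply: measurable_indic; apply: measurableC; case: (dyadic_points_negligible k).
by apply/funext => x; rewrite mulr1 rademacherE.
Qed.

Lemma ae_dyadic_sign_rademacher (c : R) k :
  {ae @lebesgue01 R, forall x, dyadic_sign k x * c = rademacher k x * c}.
Proof.
exists (dyadic_points k); have [mP P0] := dyadic_points_negligible k; split => //.
move=> x /= ne; apply: contrapT => Px; apply: ne.
by rewrite rademacherE indicE mem_set// mulr1.
Qed.

Lemma Lnorm_ae_rademacher_sum (p : R) n (f : nat -> unitIco R -> R) c :
  (forall k, measurable_fun [set: unitIco R] (f k)) ->
  (forall k, {ae @lebesgue01 R, forall x, f k x = rademacher k x * c}) ->
  'N[@lebesgue01 R]_p%:E[EFin \o (fun x => \sum_(1 <= k < n.+1) f k x)%R]%E =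
  'N[@lebesgue01 R]_p%:E[EFin \o (fun x => c * \sum_(1 <= k < n.+1) rademacher k x)%R]%E.
Proof.
move=> mf fr; rewrite !Lnorm_fin; congr (_ `^ _)%E.
have mpow (h : unitIco R -> R) : measurable_fun setT h ->
    measurable_fun setT (fun x => (`|h x| `^ p)%:E).
  move=> mh; apply/measurable_EFinP.
  by apply: (measurableT_comp (measurable_powR _)) => //; exact: measurableT_comp.
apply: ae_eq_integral => //.
- by apply: mpow; apply: measurable_sum => k; exact: mf.
- apply: mpow; apply: measurable_funM => //; apply: measurable_sum => k.
  exact: measurable_rademacher.
have : {ae @lebesgue01 R, forall x k, f k x = rademacher k x * c}.
  by apply/ae_foralln.
apply: filterS => x fx _; congr (`|_| `^ _)%:E.
by rewrite mulr_sumr; apply: eq_bigr => k _; rewrite fx mulrC.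
Qed.

(** The Rademacher functions are first traded for the dyadic signs, which form a
    martingale-difference sequence of constant modulus, so [mds_integral_eq] applies. *)
Lemma Lnorm_rademacher_sum (p : R) n : 
  ('N[@lebesgue01 R]_p%:E[EFin \o (fun x =>
     (Num.sqrt n%:R)^-1 * \sum_(1 <= k < n.+1) rademacher k x)%R] =
   (iter n (two_point (Num.sqrt n%:R)^-1) (fun w => `|w| `^ p)%R 0)%:E `^ p^-1)%E.
Proof.
set c := (Num.sqrt n%:R)^-1.
rewrite -(@Lnorm_ae_rademacher_sum p n (fun k x => dyadic_sign k x * c)).
- rewrite Lnorm_fin; congr (_ `^ _)%E.
  apply: (mds_integral_eq (dyadic_sign_mds c n) (g := fun w => `|w| `^ p)).
    move=> k x _; rewrite normrM normr_dyadic_sign mul1r ger0_norm//.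
    by rewrite invr_ge0 sqrtr_ge0.
  by move=> x; exact: powR_ge0.
- by move=> k; exact: measurable_dyadic_sign.
- by move=> k; exact: ae_dyadic_sign_rademacher.
Qed.

End dyadic_signs.

(* The functions r_k = sign sin (2^k pi x) vanish at dyadic points, so they are
   adapted to the dyadic partitions only up to a null set: the second part gives
   the equality for d_k = r_k / sqrt n itself and for a sequence equal to it
   almost everywhere which is a martingale-difference sequence. *)
Theorem corollary1p1 (R : realType) (p : R) (n : nat)
    (hp : 3 <= p) (hn : (1 <= n)%N) :
  (forall (dd : measure_display) (X : measurableType dd) (mu : probability X R)
      (D : nat -> set (set X)) (d : nat -> X -> R),
    discrete_mds mu D n d ->
    ('N[mu]_p%:E[EFin \o (fun x => \sum_(1 <= k < n.+1) d k x)%R] <=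
     'N[@lebesgue01 R]_p%:E[EFin \o (fun x =>
        (Num.sqrt n%:R)^-1 * \sum_(1 <= k < n.+1) rademacher k x)%R] *
     'N[mu]_+oo[square_function mu D d n])%E)
  /\
  (let d := fun (k : nat) (x : unitIco R) => rademacher k x / Num.sqrt n%:R in
   let sharp := fun e : nat -> unitIco R -> R =>
     ('N[@lebesgue01 R]_p%:E[EFin \o (fun x => \sum_(1 <= k < n.+1) e k x)%R] =
      'N[@lebesgue01 R]_p%:E[EFin \o (fun x =>
        (Num.sqrt n%:R)^-1 * \sum_(1 <= k < n.+1) rademacher k x)%R] *
      'N[@lebesgue01 R]_+oo[square_function lebesgue01 (dyadic_partition R) e n])%E in
   sharp d /\
   exists e : nat -> unitIco R -> R,
     [/\ discrete_mds lebesgue01 (dyadic_partition R) n e,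
         forall k, (1 <= k <= n)%N ->
           {ae @lebesgue01 R, forall x, e k x = d k x}
       & sharp e]).
Proof.
split=> [dd X mu D d mds|].
  rewrite Lnorm_rademacher_sum.
  have [Nfin|] := boolP ('N[mu]_+oo[square_function mu D d n]%E \is a fin_num).
    exact: mds_Lnorm_le.
  (* With an infinite square function the right side is [+oo], provided the Rademacher moment is not
     zero. The all-plus signs give the sum [n / sqrt n], nonzero because [n >= 1]. *)
  rewrite ge0_fin_numE ?Lnorm_ge0// -leNgt leye_eq => /eqP ->.
  rewrite gt0_muley ?leey// poweR_EFin lte_fin powR_gt0//.
  apply: iter_two_point_gt0 => [y|]; first exact: powR_ge0.
  rewrite add0r powR_gt0// normr_gt0 mulf_neq0 ?invr_neq0 ?gt_eqF ?sqrtr_gt0 ?ltr0n//.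
set c := (Num.sqrt n%:R)^-1.
have n0 : 0 < n%:R :> R by rewrite ltr0n.
have c0 : 0 <= c by rewrite invr_ge0 sqrtr_ge0.
(* This is the constant value of the square function when every [|e k|] equals [c] almost
   everywhere. *)
have nc : Num.sqrt (n%:R * c ^+ 2) = 1.
  by rewrite exprVn sqr_sqrtr ?ler0n// mulfV ?gt_eqF// sqrtr1.
move=> d sharp.
have ade k : {ae @lebesgue01 R, forall x, dyadic_sign k x * c = d k x}.
  exact: ae_dyadic_sign_rademacher.
(* Both norms ignore null sets, so one argument serves [d] itself and its dyadic-sign version. *)
have sharpP (e : nat -> unitIco R -> R) :
    (forall k, measurable_fun [set: unitIco R] (e k)) ->
    (forall k, {ae @lebesgue01 R, forall x, e k x = d k x}) -> sharp e.
  move=> me ed; rewrite /sharp (@Lnorm_ae_rademacher_sum _ p n e c)//.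
  rewrite (@square_function_ae_cst _ _ _ _ _ dyadic_filtration n e c) ?nc ?mule1//.
  move=> k _; apply: filterS2 (ed k) (ade k) => x -> <-.
  by rewrite normrM normr_dyadic_sign mul1r ger0_norm.
split.
  apply: sharpP => k; last by apply: aeW.
  by apply: measurable_funM => //; exact: measurable_rademacher.
exists (fun k x => dyadic_sign k x * c); split.
- exact: dyadic_sign_mds.
- by move=> k _; exact: ade.
- by apply: sharpP => k; [exact: measurable_dyadic_sign|exact: ade].
Qed.
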